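(* Let $m\geq 1$ be an integer and let $q\geq 2$ be a power of $2$. Then $$q^m<M_m(q)\leq \frac{q^{m+1}-1}{q-1}.$$ Moreover, if $m\neq 2$ or if $q=2$, then $M_m(q)>\dfrac{q^{m+2}}{q^2-1}$. Here $M_m(q)$ is the number defined in the context.
   Context: Definition of $M_m(q)$, for an integer $m\ge 1$ and $q\geq 2$ a power of $2$: (A) $q>2$ and $m$ odd. Let $m=2^{i_1}+2^{i_2}+\cdots+2^{i_\ell}$ be the $2$-adic (binary) expansion of $m$ (the $i_j$ are distinct non-negative integers). Then $$M_m(q)=\prod_{j=1}^{\ell}\left(q^{2^{i_j}}+1\right).$$ (B) $q>2$ and $m=2$. Then $M_2(q)=q^2+1$. (C) $q>2$ and $m\geq 4$ even. Let $\ell$ be the largest positive integer with $2^\ell+2^{\ell-1}\leq m$. Then $$M_m(q)=\frac{(q^{m-2^\ell+1}-1)(q^{2^\ell}-1)}{q-1}.$$ (D) $q=2$. Let $\ell$ be the largest positive integer with $2^\ell-1\leq m$ and write $m_0=m-(2^\ell-1)$. Then (with $q=2$) $$M_m(q)=\begin{cases} q^{m_0}(q^{2^\ell}-1) & \text{if } m_0\leq 3,\\ (q^{2^{\ell-1}+m_0}-1)(q^{2^{\ell-1}}-1) & \text{if } 3<m_0<2^{\ell-1},\ m_0\text{ odd},\\ q(q^{2^{\ell-1}+m_0-1}-1)(q^{2^{\ell-1}}-1) & \text{if } 3<m_0<2^{\ell-1},\ m_0\text{ even},\\ (q^{2^\ell}+1)(q^{2^{\ell-1}}-1) & \text{if }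 3<m_0,\ m_0=2^{\ell-1},\\ (q^{m_0}-1)(q^{2^\ell}-1) & \text{if } m_0>\max(3,2^{\ell-1}),\ m_0\text{ odd},\\ q(q^{m_0-1}-1)(q^{2^\ell}-1) & \text{if } m_0>\max(3,2^{\ell-1}),\ m_0\text{ even}. \end{cases}$$ *)

(* Defs.v *)
From mathcomp Require Import all_boot all_order all_algebra.
From mathcomp Require Import zify.

Set Implicit Arguments.
Unset Strict Implicit.
Unset Printing Implicit Defensive.

Import Order.TTheory GRing.Theory Num.Theory.

Local Open Scope nat_scope.

(* The exponents i_1, ..., i_l of the binary expansion of m; all of them are
   smaller than m because i < 2 ^ i. *)
Definition binary_exponents (m : nat) : seq nat :=
  [seq i <- iota 0 m | odd (m %/ 2 ^ i)].

Lemma binary_exponents_uniq m : uniq (binary_exponents m).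
Proof. by rewrite filter_uniq // iota_uniq. Qed.

Lemma binary_exponents_sum m : \sum_(i <- binary_exponents m) 2 ^ i = m.
Proof.
have digits n : m = \sum_(0 <= i < n | odd (m %/ 2 ^ i)) 2 ^ i
                      + m %/ 2 ^ n * 2 ^ n.
  elim: n => [|n IHn]; first by rewrite big_geq // divn1 muln1.
  rewrite {1}IHn (big_mkcond (fun i => odd _)) [in RHS]big_mkcond big_nat_recr //=.
  rewrite -addnA; congr (_ + _).
  rewrite expnSr divnMA divn2 -{1}(odd_double_half (m %/ 2 ^ n)).
  by case: (odd _); lia.
rewrite /binary_exponents big_filter.
have := digits m; rewrite (divn_small (ltn_expl m (ltnSn 1))) mul0n addn0.
by rewrite /index_iota subn0 => /esym.
Qed.

(* The largest positive l with 2 ^ l + 2 ^ (l - 1) <= m, for m >= 3, and the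
   largest positive l with 2 ^ l - 1 <= m, for m >= 1.  Since l < 2 ^ l, such an
   l is at most m, so that the bounded ranges lose nothing. *)
Definition ellC (m : nat) : nat :=
  \max_(1 <= l < m.+1 | 2 ^ l + 2 ^ (l - 1) <= m) l.

Definition ellD (m : nat) : nat :=
  \max_(1 <= l < m.+1 | 2 ^ l - 1 <= m) l.

Lemma ellCP m : 3 <= m ->
  [/\ 0 < ellC m, 2 ^ ellC m + 2 ^ (ellC m - 1) <= m
    & forall l, 0 < l -> 2 ^ l + 2 ^ (l - 1) <= m -> l <= ellC m].
Proof.
move=> m_ge3.
have ub l : 0 < l -> 2 ^ l + 2 ^ (l - 1) <= m -> l <= ellC m.
  move=> l_gt0 le_l; rewrite /ellC.
  apply: (leq_bigmax_seq (F := id)) => //.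
  by rewrite mem_index_iota l_gt0 /=; have := ltn_expl l (ltnSn 1); lia.
have ge1 := ub 1 isT m_ge3; split=> //.
suff: (ellC m == 0) || (2 ^ ellC m + 2 ^ (ellC m - 1) <= m).
  by case/orP=> // /eqP; lia.
rewrite /ellC; elim/big_ind: _ => // [x y Hx Hy|i ->]; last by rewrite orbT.
by rewrite /maxn; case: ifP.
Qed.

Lemma ellDP m : 1 <= m ->
  [/\ 0 < ellD m, 2 ^ ellD m - 1 <= m
    & forall l, 0 < l -> 2 ^ l - 1 <= m -> l <= ellD m].
Proof.
move=> m_ge1.
have ub l : 0 < l -> 2 ^ l - 1 <= m -> l <= ellD m.
  move=> l_gt0 le_l; rewrite /ellD.
  apply: (leq_bigmax_seq (F := id)) => //.
  by rewrite mem_index_iota l_gt0 /=; have := ltn_expl l (ltnSn 1); lia.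
split=> //; first exact: ub 1 isT m_ge1.
by rewrite /ellD; elim/big_ind: _ => // x y Hx Hy; rewrite /maxn; case: ifP.
Qed.

Local Open Scope ring_scope.

Definition M_A (m : nat) (q : rat) : rat :=
  \prod_(i <- binary_exponents m) (q ^+ (2 ^ i)%N + 1).

Definition M_C (m : nat) (q : rat) : rat :=
  let l := ellC m in
  (q ^+ (m - 2 ^ l + 1)%N - 1) * (q ^+ (2 ^ l)%N - 1) / (q - 1).

Definition M_D (m : nat) (q : rat) : rat :=
  let l := ellD m in
  let m0 := (m - (2 ^ l - 1))%N in
  let h := (2 ^ (l - 1))%N in
  if (m0 <= 3)%N then q ^+ m0 * (q ^+ (2 ^ l)%N - 1)
  else if (m0 < h)%N then
    if odd m0 then (q ^+ (h + m0)%N - 1) * (q ^+ h - 1)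
    else q * (q ^+ (h + m0 - 1)%N - 1) * (q ^+ h - 1)
  else if m0 == h then (q ^+ (2 ^ l)%N + 1) * (q ^+ h - 1)
  else
    if odd m0 then (q ^+ m0 - 1) * (q ^+ (2 ^ l)%N - 1)
    else q * (q ^+ (m0 - 1)%N - 1) * (q ^+ (2 ^ l)%N - 1).

(* Meaningful for m >= 1 and q >= 2 a power of 2.  The value is taken in rat so
   that subtraction and division are the usual ones. *)
Definition M (m q : nat) : rat :=
  if q == 2%N then M_D m q%:R
  else if odd m then M_A m q%:R
  else if m == 2%N then q%:R ^+ 2 + 1
  else M_C m q%:R.

(* Main.v *)
Require Import Defs.
From mathcomp Require Import all_boot all_order all_algebra.
From mathcomp Require Import zify ring lra.

Import Order.TTheory GRing.Theory Num.Theory.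
Local Open Scope ring_scope.

(** In cases (C) and (D), up to a power of q and with one exceptional q^a + 1,
    M_m(q) is a product (q^a - 1)(q^b - 1)/(q - 1) of leading order
    q^(m+1)/(q - 1), so both bounds reduce to comparing q^a + q^b with q^(a+b).
    In case (A), distinct sets of binary exponents give distinct subsums, so the
    expanded product is a sum of distinct powers q^k with k <= m; the factor
    q + 1, present since m is odd, gives
    M_m(q) >= (q + 1) q^(m-1) > q^(m+2)/(q^2 - 1). *)

Lemma modn_exp2S m n :
  (m %% 2 ^ n.+1 = odd (m %/ 2 ^ n) * 2 ^ n + m %% 2 ^ n)%N.
Proof.
rewrite expnS mulnC.
have := divn_eq m (2 ^ n); have := odd_double_half (m %/ 2 ^ n).
have := ltn_pmod m (expn_gt0 2 n).
set r := (m %% 2 ^ n)%N; set d := (m %/ 2 ^ n)%N; set p := (2 ^ n)%N.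
move=> lt_r d_eq m_eq.
have -> : m = (d./2 * (p * 2) + (odd d * p + r))%N.
  by rewrite [LHS]m_eq -{1}d_eq; lia.
by rewrite modnMDl modn_small //; case: (odd d); lia.
Qed.

(** Induction on the number [n] of binary digits read: the digits below [n] make up [m %% 2 ^ n], to
    which the partial product corresponds. *)
Lemma M_A_upper m (q : rat) : 1 <= q -> M_A m q * (q - 1) <= q ^+ m.+1 - 1.
Proof.
move=> q_ge1.
have step n : (\prod_(0 <= i < n | odd (m %/ 2 ^ i)) (q ^+ (2 ^ i)%N + 1))
    * (q - 1) <= q ^+ (m %% 2 ^ n).+1 - 1.
  elim: n => [|n IHn]; first by rewrite big_geq // expn0 modn1 mul1r expr1.
  rewrite big_mkcond big_nat_recr //= -big_mkcond /= modn_exp2S.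
  case: ifP => _; last by rewrite mul0n add0n mulr1.
  rewrite mul1n mulrAC -addnS exprD.
  have lt_mod : q ^+ (m %% 2 ^ n).+1 <= q ^+ (2 ^ n)%N.
    by rewrite ler_weXn2l // ltn_pmod // expn_gt0.
  have p_ge1 : 1 <= q ^+ (2 ^ n)%N by rewrite exprn_ege1.
  (* With X = q^(r+1) and P = q^(2^n), (X - 1)(P + 1) = XP - 1 + (X - P), and X <= P because r <
     2^n. *)
  apply: le_trans (_ : (q ^+ (m %% 2 ^ n).+1 - 1) * (q ^+ (2 ^ n)%N + 1) <= _).
    by rewrite ler_wpM2r //; lra.
  nra.
have := step m; rewrite (modn_small (ltn_expl m (ltnSn 1))).
by rewrite /M_A /binary_exponents big_filter /index_iota subn0.
Qed.

(** Digit 0 of an odd [m] gives the factor q + 1; every other factor is at least q^(2^i), and these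
    exponents add up to m - 1. *)
Lemma M_A_lower m (q : rat) : 0 <= q -> odd m -> (q + 1) * q ^+ m.-1 <= M_A m q.
Proof.
move=> q_ge0 m_odd; have m_gt0 := odd_gt0 m_odd.
have m_sum := binary_exponents_sum m.
have [s def_s] : exists s, binary_exponents m = (0 :: s)%N.
  rewrite /binary_exponents -(prednK m_gt0) /= prednK // expn0 divn1 m_odd.
  by eexists.
rewrite def_s big_cons expn0 in m_sum.
rewrite /M_A def_s big_cons expn0 expr1 ler_wpM2l ?addr_ge0 //.
rewrite -[in leLHS]m_sum add1n /= -prodrXr.
by apply: ler_prod => i _; rewrite exprn_ge0 //= lerDl.
Qed.

Lemma M_C_bounds m (q : rat) : 4 <= q -> (4 <= m)%N ->
  q ^+ m.+2 < M_C m q * (q ^+ 2 - 1) /\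
  M_C m q <= (q ^+ m.+1 - 1) / (q - 1).
Proof.
move=> q_ge4 m_ge4; have m_ge3 : (3 <= m)%N by lia.
have [l_gt0 le_m _] := ellCP m_ge3; rewrite /M_C.
have b_ge2 : (2 <= 2 ^ ellC m)%N by rewrite -(leq_exp2l _ _ (ltnSn 1)) in l_gt0.
have h_eq : (2 ^ ellC m = 2 * 2 ^ (ellC m - 1))%N by rewrite -expnS subn1 prednK.
set b := (2 ^ ellC m)%N in b_ge2 le_m h_eq *.
set a := (m - b + 1)%N.
(* If b = 2 then m >= 4 forces a >= 3; otherwise b >= 4 and a >= b/2 + 1 >= 3. *)
have a_ge3 : (3 <= a)%N by rewrite /a; lia.
have -> : m.+2 = (a + b).+1 by rewrite /a; lia.
have -> : m.+1 = (a + b)%N by rewrite /a; lia.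
have q_ge1 : 1 <= q by lra.
have A_ge : q ^+ 3 <= q ^+ a by rewrite ler_weXn2l.
have B_ge : q ^+ 2 <= q ^+ b by rewrite ler_weXn2l.
rewrite exprS exprD.
set A := q ^+ a in A_ge *; set B := q ^+ b in B_ge *.
have A_ge4q : 4 * q <= A by apply: le_trans A_ge; nra.
have B_ge4q : 4 * q <= B by apply: le_trans B_ge; nra.
split; last by rewrite ler_pM2r ?invr_gt0; nra.
have -> : (A - 1) * (B - 1) / (q - 1) * (q ^+ 2 - 1) = (A - 1) * (B - 1) * (q + 1).
  by field; lra.
(* The lower bound amounts to (q + 1)(A + B - 1) < AB; averaging the next two estimates gives AB >=
   2q(A + B). *)
have AB1 : 4 * q * B <= A * B by rewrite ler_wpM2r //; lra.
have AB2 : 4 * q * A <= A * B by rewrite [leRHS]mulrC ler_wpM2r //; lra.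
nra.
Qed.

(** The first bound says 3(A + B) < AB + 3, and AB >= 4(A + B) when both are at least 8. The
    constants 2 and 3 are q and q^2 - 1 at q = 2. *)
Lemma mul_pred_bounds (A B : rat) : 8 <= A -> 8 <= B ->
  2 * (A * B) < 3 * ((A - 1) * (B - 1)) /\ (A - 1) * (B - 1) <= A * B - 1.
Proof. by move=> hA hB; split; nra. Qed.

Lemma M_D_bounds m : (1 <= m)%N ->
  2 ^+ m.+2 < M_D m 2 * 3 /\ M_D m 2 <= 2 ^+ m.+1 - 1.
Proof.
move=> m_ge1; have [l_gt0 le_m l_max] := ellDP m_ge1; rewrite /M_D.
have lt_m : (m < 2 ^ (ellD m).+1 - 1)%N.
  by rewrite ltnNge; apply/negP => /(l_max _ (ltn0Sn _)); rewrite ltnn.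
have h_eq : (2 ^ ellD m = 2 * 2 ^ (ellD m - 1))%N by rewrite -expnS subn1 prednK.
have h_gt0 : (0 < 2 ^ (ellD m - 1))%N by rewrite expn_gt0.
rewrite expnS h_eq in lt_m; rewrite !h_eq in le_m *.
set h := (2 ^ (ellD m - 1))%N in h_gt0 le_m lt_m *.
set m0 := (m - (2 * h - 1))%N.
have m0_lt : (m0 < 2 * h)%N by rewrite /m0; lia.
have -> : m.+1 = (m0 + 2 * h)%N by rewrite /m0; lia.
rewrite [2 ^+ _.+1]exprS.
have ge_pow k n : (k <= n)%N -> 2 ^+ k <= 2 ^+ n :> rat.
  by move=> ?; rewrite ler_weXn2l //; lra.
case: ifP => [_|/negbT m0_gt3].
  (* For the value A(B - 1), the lower bound 2AB < 3A(B - 1) is just B > 3. *)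
  rewrite exprD; have : 2 ^+ 2 <= 2 ^+ (2 * h) :> rat by apply: ge_pow; lia.
  have : 2 ^+ 0 <= 2 ^+ m0 :> rat by apply: ge_pow.
  set A := _ ^+ m0; set B := _ ^+ (2 * h); move=> hA hB.
  by split; nra.
rewrite -ltnNge in m0_gt3.
have m0_pow : 2 ^+ 3 <= 2 ^+ (m0 - 1)%N :> rat by apply: ge_pow; lia.
have m0_pow' : 2 ^+ 3 <= 2 ^+ m0 :> rat by apply: ge_pow; lia.
have b_pow : 2 ^+ 3 <= 2 ^+ (2 * h)%N :> rat by apply: ge_pow; lia.
case: ifP => [m0_lth|/negbT m0_geh].
  have h_pow : 2 ^+ 3 <= 2 ^+ h :> rat by apply: ge_pow; lia.
  case: ifP => _.
    have hm_pow : 2 ^+ 3 <= 2 ^+ (h + m0)%N :> rat by apply: ge_pow; lia.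
    have -> : (m0 + 2 * h = (h + m0) + h)%N by lia.
    by rewrite exprD; have [] := mul_pred_bounds _ _ hm_pow h_pow; split; lra.
  have hm_pow : 2 ^+ 3 <= 2 ^+ (h + m0 - 1)%N :> rat by apply: ge_pow; lia.
  (* The successor splits off the extra factor q = 2 of the even case. *)
  have -> : (m0 + 2 * h = ((h + m0 - 1) + h).+1)%N by lia.
  rewrite exprS exprD.
  by have [] := mul_pred_bounds _ _ hm_pow h_pow; split; lra.
case: ifP => [/eqP m0_eq|_].
  (* With B = 2^h the value is (B^2 + 1)(B - 1), to be compared with B^3; the lower bound becomes (B
     - 1)^3 > 2. *)
  rewrite m0_eq in m0_pow' *; rewrite exprD mulnC exprM.
  by set B := 2 ^+ h in m0_pow' *; split; nra.
case: ifP => _.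
  by rewrite exprD; have [] := mul_pred_bounds _ _ m0_pow' b_pow; split; lra.
have -> : (m0 + 2 * h = ((m0 - 1) + 2 * h).+1)%N by lia.
rewrite exprS exprD.
by have [] := mul_pred_bounds _ _ m0_pow b_pow; split; lra.
Qed.

Theorem lemma2p3 (m q : nat) (hm : (1 <= m)%N) (hq : (2 <= q)%N)
    (hq2 : exists k : nat, q = (2 ^ k)%N) :
  (q%:R ^+ m < M m q /\
   M m q <= (q%:R ^+ m.+1 - 1) / (q%:R - 1)) /\
  (m <> 2%N \/ q = 2%N -> q%:R ^+ m.+2 / (q%:R ^+ 2 - 1) < M m q).
Proof.
have q_ge2 : 2 <= q%:R :> rat by rewrite ler_nat.
have q2_gt1 : 0 < q%:R ^+ 2 - 1 :> rat by nra.
have q1_gt0 : 0 < q%:R - 1 :> rat by lra.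
have qm_gt0 : 0 < q%:R ^+ m :> rat by rewrite exprn_gt0 //; lra.
(* Since q^(m+2)/(q^2 - 1) > q^m, the bound q^m < M needs its own proof only when m = 2 and q >
   2. *)
suff [upper [lower1 lower2]] : M m q <= (q%:R ^+ m.+1 - 1) / (q%:R - 1) /\
    (m = 2%N /\ q <> 2%N -> q%:R ^+ m < M m q) /\
    (m <> 2%N \/ q = 2%N -> q%:R ^+ m.+2 < M m q * (q%:R ^+ 2 - 1)).
  split; last by move=> /lower2; rewrite ltr_pdivrMr.
  split=> //; have [/lower1 //|/lower2 lt_M] :
    (m = 2%N /\ q <> 2%N) \/ (m <> 2%N \/ q = 2%N) by lia.
  rewrite -(ltr_pM2r q2_gt1); apply: le_lt_trans lt_M.
  by rewrite !exprS; nra.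
rewrite /M; case: eqP => [->|q_neq2].
  have [lower upper] := M_D_bounds m hm.
  have -> : 2 - 1 = 1 :> rat by ring.
  have -> : 2 ^+ 2 - 1 = 3 :> rat by ring.
  by rewrite divr1; split=> //; split=> // -[].
have q_ge4 : 4 <= q%:R :> rat.
  rewrite ler_nat; case: hq2 hq q_neq2 => -[|[|k]] -> //.
  by rewrite !expnS; have := expn_gt0 2 k; lia.
case: ifP => [m_odd|m_even].
  split; first by rewrite ler_pdivlMr // M_A_upper //; lra.
  split=> [[m2 _]|_]; first by rewrite m2 in m_odd.
  have M_ge := M_A_lower m q%:R (ler0n _ q) m_odd.
  rewrite -(ler_pM2r q2_gt1) in M_ge; apply: lt_le_trans M_ge.
  have -> : m.+2 = (3 + m.-1)%N by lia.
  have : 0 < q%:R ^+ m.-1 :> rat by rewrite exprn_gt0 //; lra.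
  rewrite exprD; set P := _ ^+ m.-1 => P_gt0.
  (* After cancelling [P], what remains is q^3 < (q + 1)(q^2 - 1), that is, q + 1 < q^2. *)
  by rewrite [ltRHS]mulrAC ltr_pM2r //; nra.
case: eqP => [->|m_neq2].
  split; last by split=> [_|[]//]; lra.
  by rewrite ler_pdivlMr // !exprS expr0; nra.
have m_ge4 : (4 <= m)%N by lia.
by have [] := M_C_bounds m q%:R q_ge4 m_ge4; split=> //; split=> // -[].
Qed.
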